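(* Let $n\ge1$ and $N$ be positive integers, and let $r_{ij}>0$ with $r_{ij}=r_{ji}$ for $1\le i\neq j\le N$. Then for any $0<p_j<\infty$ ($1\le j\le N$) satisfying $$\frac1{p_j}=\frac1{2n}\sum_{i\ne j}r_{ij}\ \ (1\le j\le N),\qquad \sum_{j=1}^N\frac1{p_j}=\frac1n\sum_{1\le i<j\le N}r_{ij},$$ there is a finite constant $C_{p_j,r_{ij},n,N}$ such that $$\prod_{j=1}^N\|f_j\|_{p_j}\le C_{p_j,r_{ij},n,N}\,\sup_{y_1,\dots,y_N}\ \prod_{j=1}^Nf_j(y_j)\prod_{1\le i<j\le N}|y_i-y_j|^{r_{ij}}$$ for all nonnegative measurable functions $f_1,\dots,f_N$ on $\mathbb{R}^n$.
   Context: $\|f\|_p=(\int_{\mathbb{R}^n}|f|^p\,dx)^{1/p}\in[0,\infty]$ with respect to Lebesgue measure (also for $p<1$), with the usual convention $0\cdot\infty=0$ in products. $\sup$ denotes the essential supremum with respect to Lebesgue measure on $(\mathbb{R}^n)^N$. In $\sum_{i\neq j}r_{ij}$, $j$ is fixed and the sum is over $i\in\{1,\dots,N\}\setminus\{j\}$. *)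

(* Defs.v *)
From HB Require Import structures.
From mathcomp Require Import all_boot all_order all_algebra.
From mathcomp Require Import all_classical all_reals all_analysis.
From mathcomp Require Import measurable_realfun ess_sup_inf.
Import Order.TTheory GRing.Theory Num.Theory.
Import numFieldNormedType.Exports.

Set Implicit Arguments.
Unset Strict Implicit.
Unset Printing Implicit Defensive.

Local Open Scope classical_set_scope.
Local Open Scope ring_scope.
Local Open Scope ereal_scope.

(* The n-fold product mu x ... x mu on n.-tuple T, obtained by iterating the
   binary product measure along the isomorphism T * n.-tuple T = n.+1.-tuple T;
   tuple_measureX below gives its value on rectangles. *)
Section tuple_measure.
Context d (T : measurableType d) (R : realType).
Variable mu : {sigma_finite_measure set T -> \bar R}.

Definition tuple_cons n (z : T * n.-tuple T) : n.+1.-tuple T :=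
  [tuple of z.1 :: z.2].

Lemma measurable_tuple_cons n : measurable_fun [set: _] (@tuple_cons n).
Proof. exact: measurable_cons. Qed.

Section step.
Variables (n : nat) (m : {sigma_finite_measure set (n.-tuple T) -> \bar R}).

Definition tuple_measureS : set (n.+1.-tuple T) -> \bar R :=
  pushforward (mu \x m) (@tuple_cons n).

HB.instance Definition _ := Measure.copy tuple_measureS
  (measure_function_pushforward__canonical__measure_function_Measure
     (mu \x m) (@measurable_tuple_cons n)).

Lemma tuple_measureS_sigma_finite : sigma_finite [set: _] tuple_measureS.
Proof.
have /sigma_finiteP[F [TF ndF Foo]] := sigma_finiteT mu.
have /sigma_finiteP[G [TG ndG Goo]] := sigma_finiteT m.
pose u (t : n.+1.-tuple T) : T * n.-tuple T := (thead t, [tuple of behead t]).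
have mu_ : measurable_fun [set: _] u.
  apply/measurable_fun_pairP; split; last exact: measurable_behead.
  exact: measurable_tnth.
have uK z : u (tuple_cons z) = z.
  case: z => a t; rewrite /u /tuple_cons /=; congr (_, _).
  exact/val_inj.
exists (fun k => u @^-1` (F k `*` G k)).
  apply/seteqP; split=> // t _.
  have [i _ Fi] : (\bigcup_i F i) (u t).1 by rewrite -TF.
  have [j _ Gj] : (\bigcup_j G j) (u t).2 by rewrite -TG.
  exists (maxn i j) => //; split.
    by move: Fi; exact/subsetPset/ndF/leq_maxl.
  by move: Gj; exact/subsetPset/ndG/leq_maxr.
move=> k; have [mF Fk] := Foo k; have [mG Gk] := Goo k; split.
  by rewrite -[X in measurable X]setTI; apply: mu_ => //; exact: measurableX.
rewrite /tuple_measureS /pushforward /= -comp_preimage.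
have -> : u \o @tuple_cons n = id by apply/funext => z; exact: uK.
by rewrite preimage_id product_measure1E// lte_mul_pinfty// ge0_fin_numE.
Qed.

HB.instance Definition _ := Measure_isSigmaFinite.Build _ _ _ tuple_measureS
  tuple_measureS_sigma_finite.
End step.

Fixpoint tuple_measure n : {sigma_finite_measure set (n.-tuple T) -> \bar R} :=
  if n is n'.+1 then tuple_measureS (tuple_measure n')
  else \d_([tuple] : 0.-tuple T).

Lemma tuple_measureX n (A : 'I_n -> set T) : (forall i, measurable (A i)) ->
  tuple_measure n [set t | forall i, A i (tnth t i)] = \prod_(i < n) mu (A i).
Proof.
elim: n A => [|n IHn] A mA.
  by rewrite big_ord0 /= diracE mem_set// => -[].
rewrite big_ord_recl -IHn//= /tuple_measureS /pushforward.
pose B : set (n.-tuple T) := [set t | forall i, A (lift ord0 i) (tnth t i)].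
rewrite (_ : _ @^-1` _ = A ord0 `*` B); last first.
  apply/seteqP; split=> [[a t] /= At|[a t] /= [Aa Bt] i].
    split=> [|i]; first exact: (At ord0).
    by have := At (lift ord0 i); rewrite /tuple_cons/= tnthS.
  case: (unliftP ord0 i) => [j ->|->] /=; last by rewrite /tuple_cons tnth0.
  by rewrite /tuple_cons tnthS; exact: Bt.
rewrite product_measure1E//.
rewrite (_ : B = \bigcap_(i in [set: 'I_n]) (@tnth n T ^~ i) @^-1` A (lift ord0 i)).
  apply: fin_bigcap_measurable => // i _.
  by rewrite -[X in measurable X]setTI; exact: measurable_tnth.
by apply/seteqP; split=> [t Bt i _|t Bt i]; [exact: Bt|exact: (Bt i I)].
Qed.
End tuple_measure.

Section completed_measurable_fun.
Context d (T : measurableType d) (R : realType).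
Variable mu : {measure set T -> \bar R}.

(* measurability with respect to the completion of mu *)
Definition completed_measurable_fun (f : T -> \bar R) :=
  forall B : set \bar R, measurable B -> completed_algebra_gen mu (f @^-1` B).

Import HBNNSimple.

(* The library integral of a nonnegative function is the supremum of the
   integrals of the measurable simple functions below it. On functions that are
   only measurable for the completion of mu it is therefore still the integral
   with respect to the completion. *)
Lemma completed_measurable_fun_integral (f : T -> \bar R) :
  completed_measurable_fun f -> (forall x, 0 <= f x) ->
  exists g : T -> \bar R, [/\ measurable_fun [set: T] g,
    forall x, 0 <= g x <= f x, f = g %[ae mu] &
    \int[mu]_x f x = \int[mu]_x g x].
Proof.
move=> mf f0.
pose q (n : nat) : R :=
  if unpickle n is Some r then Num.max 0%R (ratr (r : rat)) else 0%R.
have q0 n : (0 <= q n)%R.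
  by rewrite /q; case: unpickle => // r; rewrite le_max lexx.
have {}mf n : exists A, [/\ measurable A, A `<=` [set x | (q n)%:E < f x] &
    mu.-negligible ([set x | (q n)%:E < f x] `\` A)].
  have [|A mA [N nN ANE]] := mf `](q n)%:E, +oo[%classic; first exact: emeasurable_itv.
  have E : f @^-1` `](q n)%:E, +oo[%classic = [set x | (q n)%:E < f x].
    by apply/seteqP; split=> x /=; rewrite in_itv/= andbT.
  rewrite E in ANE; exists A; split=> //; rewrite -ANE; first exact: subsetUl.
  by apply: negligibleS nN => x [[]].
have {mf}[A mA] := choice mf.
pose h n x := (q n * \1_(A n) x)%:E.
pose g x := ereal_sup (range (h ^~ x)).
have g0 x : 0 <= g x.
  apply: le_trans (_ : h 0%N x <= _); last by apply: ereal_sup_ubound; exists 0%N.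
  by rewrite lee_fin mulr_ge0.
have gf x : g x <= f x.
  apply: ge_ereal_sup => _ [n _ <-]; rewrite /h indicE.
  case: (boolP (x \in A n)) => [/set_mem xA|_]; last by rewrite mulr0.
  by rewrite mulr1; apply: ltW; case: (mA n) => _ /(_ _ xA).
have mg : measurable_fun [set: T] g.
  have : measurable_fun [set: T] (fun x => esups (h ^~ x) 0%N).
    apply: measurable_fun_esups => n; apply/measurable_EFinP.
    apply: measurable_funM; first exact: measurable_cst.
    by apply/measurable_indicP; case: (mA n).
  apply: eq_measurable_fun => x _; rewrite /esups /sdrop /g.
  congr ereal_sup; apply/seteqP; split=> _ [n _ <-]; by exists n.
have fg : f = g %[ae mu].
  have nA n : mu.-negligible ([set x | (q n)%:E < f x] `\` A n) by case: (mA n).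
  apply: negligibleS (negligible_bigcup nA).
  move=> x /= /not_implyP [_ fgx].
  have gx_lt : g x < f x by rewrite lt_neqAle gf andbT; apply/eqP => /esym.
  have [r gxE] : exists r, g x = r%:E.
    by move: (g0 x) gx_lt; case: (g x) => [r||]// _; [exists r|rewrite ltNge leey].
  have [s [rs sf]] : exists s, (r < s)%R /\ s%:E <= f x.
    move: gx_lt; rewrite gxE; case: (f x) => [y||]//.
      by rewrite lte_fin; exists y.
    by exists (r + 1)%R; rewrite ltrDl ltr01 leey.
  have [a] := rat_in_itvoo rs; rewrite inE/= => /andP[ra as_].
  have a0 : (0 <= ratr a :> R)%R.
    by apply: le_trans (ltW ra); rewrite -lee_fin -gxE.
  have qE : q (pickle a) = ratr a by rewrite /q pickleK max_r.
  exists (pickle a) => //; split.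
    rewrite /= qE.
    by apply: lt_le_trans sf; rewrite lte_fin.
  move=> Ax; move: ra; apply/negP; rewrite -leNgt -lee_fin -gxE.
  apply: ereal_sup_ubound; exists (pickle a) => //.
  by rewrite /h indicE mem_set// mulr1 qE.
exists g; split=> //; first by move=> x; rewrite g0 gf.
apply/eqP; rewrite eq_le; apply/andP; split.
  rewrite ge0_integralTE//; apply: ge_ereal_sup => _ [k /= kf <-].
  rewrite -integralT_nnsfun; apply: ae_ge0_le_integral => //.
  - by move=> x _; rewrite lee_fin; exact: fun_ge0.
  - by apply/measurable_EFinP; exact: measurable_funPT.
  - by apply: filterS fg => x /= /(_ I) <- _.
rewrite [leLHS]ge0_integralTE// [leRHS]ge0_integralTE//.
apply: ge_ereal_sup => _ [k /= kg <-]; apply: ereal_sup_ubound; exists k => //=.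
by move=> x; exact: le_trans (kg x) (gf x).
Qed.

End completed_measurable_fun.

Notation Rn R n := (n.-tuple (measurableTypeR R)).

(* Lebesgue measure on the Borel sets of R^n *)
Definition lebesgue (R : realType) (n : nat) :
    {sigma_finite_measure set (Rn R n) -> \bar R} :=
  tuple_measure (@lebesgue_measure R) n.

(* Lebesgue measure on the Borel sets of (R^n)^N *)
Definition lebesgue_pow (R : realType) (n N : nat) :
    {sigma_finite_measure set (N.-tuple (Rn R n)) -> \bar R} :=
  tuple_measure (lebesgue R n) N.

Definition Lebesgue_measurable_fun (R : realType) (n : nat)
    (f : Rn R n -> \bar R) :=
  completed_measurable_fun (lebesgue R n) f.

Definition euclidean_dist (R : realType) (n : nat) (x y : Rn R n) : R :=
  Num.sqrt (\sum_(k < n) (tnth x k - tnth y k : R) ^+ 2).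

(* Main.v *)
Require Import Defs.
From HB Require Import structures.
From mathcomp Require Import all_boot all_order all_algebra.
From mathcomp Require Import all_classical all_reals all_analysis.
From mathcomp Require Import measurable_realfun ess_sup_inf.
From mathcomp Require Import ring lra.

(** Write [F_j = f_j ^ p_j] and normalize these to probability densities. The
    relation between the [p_j] and the [r_ij] says exactly that the functional
    under the supremum is the product over pairs [i < j] of
    [(F_i(y_i) F_j(y_j) |y_i - y_j|^(2n)) ^ (r_ij / 2n)],
    so the theorem asserts that this product cannot be uniformly small
    (lemma [prod_pair_bound]).

    The supremum is bounded from below by drawing the points [y_j] independently
    with densities [F_j]. If the whole product is small, then one of the pair
    factors is small. For a single pair this is an unlikely event:
    [F(x) G(y) |x - y|^(2n) < s^2] has probability at most a constant times [s].
    Indeed, by symmetry consider only the part where [G(y) <= F(x)], and fix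
    [x]. Then [G(y)] is at most [F(x)], and at most [s^2 / F(x)] times
    [|x - y|^(-2n)]. The first bound is used for [|x - y|^n <= s / F(x)], the
    second one beyond; each contributes a multiple of [s] to the integral of
    [G], whatever the value of [F(x)] (lemma [integral_near_pair_le]). For [s]
    small in terms of [n] and [N] the union bound over all pairs leaves a set of
    positive measure on which every pair factor is at least [s^2], which bounds
    the essential supremum from below (lemma [densities_lower_bound]).

    It remains to reach densities: the [F_j] are replaced by Borel minorants of
    finite integral, and these integrals are taken arbitrarily close to those
    of the [F_j], or arbitrarily large if these are infinite. *)

Import Order.TTheory GRing.Theory Num.Theory.
Import numFieldNormedType.Exports.

Set Implicit Arguments.
Unset Strict Implicit.
Unset Printing Implicit Defensive.

Local Open Scope classical_set_scope.
Local Open Scope ring_scope.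
Local Open Scope ereal_scope.

(** * Integration over tuples of independent points *)

Section tuple_tonelli.
Context d (T : measurableType d) (R : realType).
Variable mu : {sigma_finite_measure set T -> \bar R}.

Lemma tuple_cons_tnth0 n (x : T) (t : n.-tuple T) :
  tnth (tuple_cons (x, t)) ord0 = x.
Proof. by rewrite /tuple_cons tnth0. Qed.

Lemma tuple_cons_tnthS n (x : T) (t : n.-tuple T) i :
  tnth (tuple_cons (x, t)) (lift ord0 i) = tnth t i.
Proof. by rewrite /tuple_cons tnthS. Qed.

Lemma ge0_integral_tupleS n (phi : n.+1.-tuple T -> \bar R) :
  measurable_fun [set: _] phi -> (forall t, 0 <= phi t) ->
  \int[tuple_measure mu n.+1]_t phi t =
  \int[mu]_x \int[tuple_measure mu n]_t phi (tuple_cons (x, t)).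
Proof.
move=> mphi phi0.
have mc := @measurable_tuple_cons _ T n.
transitivity (\int[pushforward (mu \x tuple_measure mu n)
    (@tuple_cons _ T n)]_t phi t).
  by [].
rewrite (ge0_integral_pushforward mc)// preimage_setT.
rewrite fubini_tonelli1//; last by move=> z; exact: phi0.
exact: (measurableT_comp mphi mc).
Qed.

Lemma emeasurable_prod_seq (I : Type) (s : seq I) (F : I -> T -> \bar R) :
  (forall k, measurable_fun [set: T] (F k)) ->
  measurable_fun [set: T] (fun t => \prod_(k <- s) F k t).
Proof.
move=> mF; elim: s => [|k s IH].
  by under eq_fun do rewrite big_nil; exact: measurable_cst.
by under eq_fun do rewrite big_cons; exact: emeasurable_funM.
Qed.

End tuple_tonelli.

Lemma measurable_prod_tnth d (T : measurableType d) (R : realType) n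
    (F : 'I_n -> T -> \bar R) :
  (forall k, measurable_fun [set: T] (F k)) ->
  measurable_fun [set: n.-tuple T] (fun t => \prod_(k < n) F k (tnth t k)).
Proof.
move=> mF; apply: emeasurable_prod_seq => k.
by apply: measurableT_comp (mF k) _; exact: measurable_tnth.
Qed.

Section prod_integrals.
Context d (T : measurableType d) (R : realType).
Variable mu : {sigma_finite_measure set T -> \bar R}.

Lemma ge0_integral_prod_tnth n (F : 'I_n -> T -> \bar R) :
  (forall k, measurable_fun [set: T] (F k)) -> (forall k x, 0 <= F k x) ->
  \int[tuple_measure mu n]_t \prod_(k < n) F k (tnth t k) =
  \prod_(k < n) \int[mu]_x F k x.
Proof.
elim: n F => [|n IH] F mF F0.
  under eq_integral do rewrite big_ord0.
  by rewrite big_ord0 integral_cst//= diracE mem_set// mule1.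
rewrite ge0_integral_tupleS; last 2 first.
- exact: measurable_prod_tnth.
- by move=> t; exact: prode_ge0.
rewrite big_ord_recl -IH// -ge0_integralZr//; last first.
  by apply: integral_ge0 => t _; exact: prode_ge0.
apply: eq_integral => x _; rewrite -ge0_integralZl//; last 2 first.
- exact: (measurable_prod_tnth (fun k => mF (lift ord0 k))).
- by move=> t _; exact: prode_ge0.
apply: eq_integral => t _; rewrite big_ord_recl tuple_cons_tnth0.
by congr (_ * _); apply: eq_bigr => k _; rewrite tuple_cons_tnthS.
Qed.

Section densities.
Variables (n : nat) (F : 'I_n -> T -> \bar R).
Hypothesis mF : forall k, measurable_fun [set: T] (F k).
Hypothesis F0 : forall k x, 0 <= F k x.

Lemma ge0_integral_prod_tnth_mark (j : 'I_n) (g : T -> \bar R) :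
  (forall k, k != j -> \int[mu]_x F k x = 1) ->
  measurable_fun [set: T] g -> (forall x, 0 <= g x) ->
  \int[tuple_measure mu n]_t (\prod_(k < n) F k (tnth t k) * g (tnth t j)) =
  \int[mu]_x (F j x * g x).
Proof.
move=> F1 mg g0.
(* The factor [g] is absorbed into the j-th density. *)
pose G k x := if k == j then F k x * g x else F k x.
transitivity (\int[tuple_measure mu n]_t \prod_(k < n) G k (tnth t k)).
  apply: eq_integral => t _; rewrite (bigD1 j)//= [RHS](bigD1 j)//=.
  rewrite /G eqxx muleAC; congr (_ * _).
  by apply: eq_bigr => k /negPf ->.
rewrite ge0_integral_prod_tnth; last 2 first.
- by move=> k; rewrite /G; case: (k == j) => //; exact: emeasurable_funM.
- by move=> k x; rewrite /G; case: (k == j) => //; exact: mule_ge0.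
rewrite (bigD1 j)//= [X in _ * X]big1 ?mule1.
  by apply: eq_integral => x _; rewrite /G eqxx.
move=> k kj; rewrite -[RHS](F1 k kj).
by apply: eq_integral => x _; rewrite /G (negPf kj).
Qed.

End densities.

Lemma integral_density_mul_le (e : \bar R) (g h : T -> \bar R) :
  measurable_fun [set: T] g -> (forall x, 0 <= g x) ->
  measurable_fun [set: T] h -> (forall x, 0 <= h x) -> 0 <= e ->
  \int[mu]_x g x = 1 -> (forall x, h x <= e) -> \int[mu]_x (g x * h x) <= e.
Proof.
move=> mg g0 mh h0 e0 g1 he.
apply: le_trans (_ : \int[mu]_x (g x * e) <= _).
  apply: ge0_le_integral => //.
  - by move=> x _; rewrite mule_ge0.
  - exact: emeasurable_funM.
  - by apply: emeasurable_funM => //; exact: measurable_cst.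
  - by move=> x _; rewrite lee_wpmul2l.
by rewrite ge0_integralZr// g1 mul1e.
Qed.

(** For independent random points [t_k] of densities [F k], an expectation of
    [K (t_i, t_j)] can be bounded by conditioning on [t_i] and averaging over
    [t_j] only, since the other points integrate to 1. The induction peels off
    the coordinate 0, which may be [t_i], [t_j] or a spectator; when it is
    [t_j], the order of integration has to be exchanged in order to bring the
    integral over [t_j] inside. *)
Lemma ge0_integral_prod_tnth_pair_le n (F : 'I_n -> T -> \bar R)
    (K : T * T -> \bar R) (e : \bar R) (i j : 'I_n) :
  (forall k, measurable_fun [set: T] (F k)) -> (forall k x, 0 <= F k x) ->
  (forall k, \int[mu]_x F k x = 1) ->
  measurable_fun [set: _] K -> (forall z, 0 <= K z) -> 0 <= e ->
  i != j -> (forall x, \int[mu]_y (F j y * K (x, y)) <= e) ->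
  \int[tuple_measure mu n]_t
    (\prod_(k < n) F k (tnth t k) * K (tnth t i, tnth t j)) <= e.
Proof.
move=> + + + mK K0 e0.
elim: n F i j => [F []//|n IH] F i j mF F0 F1 ij Fje.
have mKt m (a b : 'I_m) :
    measurable_fun [set: m.-tuple T] (fun t => K (tnth t a, tnth t b)).
  apply: measurableT_comp mK _.
  by apply: measurable_fun_pair; exact: measurable_tnth.
have mKx x : measurable_fun [set: T] (fun y => K (x, y)).
  exact: measurable_fun_pair2.
have mKy y : measurable_fun [set: T] (fun x => K (x, y)).
  exact: measurable_fun_pair1.
have mPt : measurable_fun [set: n.-tuple T]
    (fun t => \prod_(k < n) F (lift ord0 k) (tnth t k)).
  exact: (measurable_prod_tnth (fun k => mF (lift ord0 k))).
have P0 (t : n.-tuple T) : 0 <= \prod_(k < n) F (lift ord0 k) (tnth t k).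
  exact: prode_ge0.
rewrite ge0_integral_tupleS; last 2 first.
- by apply: emeasurable_funM; [exact: (measurable_prod_tnth mF)|exact: mKt].
- by move=> t; rewrite mule_ge0//; exact: prode_ge0.
pose H (z : T * n.-tuple T) := \prod_(k < n) F (lift ord0 k) (tnth z.2 k) *
  K (tnth (tuple_cons z) i, tnth (tuple_cons z) j).
have mH : measurable_fun [set: _] H.
  apply: emeasurable_funM; first exact: (measurableT_comp mPt measurable_snd).
  exact: (measurableT_comp (mKt _ i j) (@measurable_tuple_cons _ T n)).
have H0 z : 0 <= H z by rewrite mule_ge0.
have split_head x : \int[tuple_measure mu n]_t
      (\prod_(k < n.+1) F k (tnth (tuple_cons (x, t)) k) *
       K (tnth (tuple_cons (x, t)) i, tnth (tuple_cons (x, t)) j)) =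
    F ord0 x * \int[tuple_measure mu n]_t H (x, t).
  rewrite -ge0_integralZl//; last exact: measurable_fun_pair2.
  apply: eq_integral => t _; rewrite big_ord_recl tuple_cons_tnth0 -muleA.
  congr (_ * (_ * _)).
  by apply: eq_bigr => k _; rewrite tuple_cons_tnthS.
under eq_integral do rewrite split_head.
have avg_head : (forall x, \int[tuple_measure mu n]_t H (x, t) <= e) ->
    \int[mu]_x (F ord0 x * \int[tuple_measure mu n]_t H (x, t)) <= e.
  apply: integral_density_mul_le => //; last by move=> x; exact: integral_ge0.
  exact: measurable_fun_fubini_tonelli_F.
rewrite /H in avg_head *.
have [i' Ei|Ei] := unliftP ord0 i; have [j' Ej|Ej] := unliftP ord0 j.
- apply: avg_head => x; rewrite Ei Ej.
  under eq_integral do rewrite !tuple_cons_tnthS.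
  apply: (IH (fun k => F (lift ord0 k))) => //.
    by apply: contra ij => /eqP ij'; rewrite Ei Ej ij'.
  by move=> y; rewrite -Ej.
- (* Coordinate 0 is [t_j]: exchange the integrals over [t_j] and [t_i]. *)
  rewrite Ei Ej; under eq_integral => x _.
    under eq_integral do rewrite tuple_cons_tnthS tuple_cons_tnth0.
    rewrite (ge0_integral_prod_tnth_mark (F := fun k => F (lift ord0 k))
      _ _ _ (mKy x))//.
    rewrite -ge0_integralZl//; last 2 first.
    - exact: emeasurable_funM.
    - by move=> y _; rewrite mule_ge0.
    over.
  have mFFK : measurable_fun [set: T * T]
      (fun z => F ord0 z.1 * (F (lift ord0 i') z.2 * K (z.2, z.1))).
    apply: emeasurable_funM.
      by apply: (measurableT_comp (mF ord0)); exact: measurable_fst.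
    apply: emeasurable_funM.
      exact: (measurableT_comp (mF _) measurable_snd).
    apply: (measurableT_comp mK).
    exact: (measurable_fun_pair measurable_snd measurable_fst).
  have FFK0 z : 0 <= F ord0 z.1 * (F (lift ord0 i') z.2 * K (z.2, z.1)).
    by rewrite !mule_ge0.
  rewrite (fubini_tonelli _ mFFK FFK0)/=.
  under eq_integral => y _.
    under eq_integral do rewrite muleCA.
    rewrite ge0_integralZl//; last 2 first.
    - exact: emeasurable_funM.
    - by move=> x _; rewrite mule_ge0.
    over.
  apply: integral_density_mul_le => //; last 2 first.
  - by move=> y; apply: integral_ge0 => x _; rewrite mule_ge0.
  - by move=> y; rewrite -Ej.
  apply: (@measurable_fun_fubini_tonelli_F _ _ _ _ _ _
    (fun z => F ord0 z.2 * K z)).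
  - apply: emeasurable_funM => //.
    exact: (measurableT_comp (mF ord0) measurable_snd).
  - by move=> z; rewrite mule_ge0.
- apply: avg_head => x; rewrite Ei Ej.
  under eq_integral do rewrite tuple_cons_tnthS tuple_cons_tnth0.
  rewrite (ge0_integral_prod_tnth_mark (F := fun k => F (lift ord0 k))
      _ _ _ (mKx x))//.
  by rewrite -Ej.
- by move: ij; rewrite Ei Ej eqxx.
Qed.

End prod_integrals.

(** * Rarity of close points *)

Section cubes.
Context (R : realType) (n : nat).
Implicit Types x y : Rn R n.

Definition cube x (rho : R) : set (Rn R n) :=
  [set y | forall k, (tnth y k : R) \in `[tnth x k - rho, tnth x k + rho]%R].

Lemma measurable_cube x rho : measurable (cube x rho).
Proof.
rewrite (_ : cube x rho = \bigcap_(k in [set: 'I_n])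
    (@tnth n (measurableTypeR R) ^~ k) @^-1`
      [set` `[tnth x k - rho, tnth x k + rho]%R]).
  apply: fin_bigcap_measurable => // k _.
  by rewrite -[X in measurable X]setTI; exact: measurable_tnth.
by apply/seteqP; split=> [t xt k _|t xt k]; [exact: xt|exact: (xt k I)].
Qed.

Lemma lebesgue_cube x rho : (0 < rho)%R ->
  lebesgue R n (cube x rho) = ((2 * rho) ^+ n)%:E.
Proof.
move=> rho0; pose A (k : 'I_n) : set (measurableTypeR R) :=
  [set` `[tnth x k - rho, tnth x k + rho]%R].
have mA k : measurable (A k) by exact: measurable_itv.
transitivity (\prod_(k < n) lebesgue_measure (A k)).
  exact: (tuple_measureX _ mA).
rewrite (eq_bigr (fun=> (2 * rho)%:E)) => [|k _].
  by rewrite prodEFin big_const_ord iter_mulr_1.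
rewrite lebesgue_measure_itv/= lte_fin ifT.
  by rewrite -EFinB; congr EFin; ring.
by rewrite ltrBlDr -addrA ltrDl addr_gt0.
Qed.

Lemma euclidean_dist_ge0 x y : (0 <= euclidean_dist x y)%R.
Proof. exact: sqrtr_ge0. Qed.

Lemma euclidean_distC x y : euclidean_dist x y = euclidean_dist y x.
Proof.
rewrite /euclidean_dist; congr Num.sqrt; apply: eq_bigr => k _.
by rewrite -sqrrN opprB.
Qed.

Lemma normr_tnthB_le x y k :
  (`|tnth x k - tnth y k| <= euclidean_dist x y)%R.
Proof.
rewrite -sqrtr_sqr ler_wsqrtr// (bigD1 k)//= lerDl.
by apply: sumr_ge0 => i _; exact: sqr_ge0.
Qed.

Lemma euclidean_dist_cube x y rho :
  (euclidean_dist x y < rho)%R -> cube x rho y.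
Proof.
move=> xyrho k; have := le_lt_trans (normr_tnthB_le x y k) xyrho.
by rewrite distrC ltr_distl/= in_itv/= => /andP[/ltW-> /ltW->].
Qed.

Lemma measurable_euclidean_dist :
  measurable_fun [set: Rn R n * Rn R n] (fun z => euclidean_dist z.1 z.2).
Proof.
apply: (measurableT_comp (continuous_measurable_fun (@sqrt_continuous R))).
apply: measurable_sum => k; apply: measurable_funX; apply: measurable_funB.
  exact: (measurableT_comp (measurable_tnth k) measurable_fst).
exact: (measurableT_comp (measurable_tnth k) measurable_snd).
Qed.

Hypothesis n_gt0 : (0 < n)%N.

(** [g] has the two upper bounds [a] and [a * (rho / d) ^+ (2 * n)], where [d]
    is the distance from [x] to [y] and [rho] is the radius at which they
    agree. Since [d] is known up to a factor 2 from the dyadic cubes of radius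
    [rho * 2 ^+ k] that contain [y], the smaller of the two bounds is known from
    them up to a factor [4 ^+ n]. *)
Lemma dyadic_layer (a s rho : R) x y (g : R) :
  (0 < a)%R -> (0 < rho)%R -> (s = a * rho ^+ n)%R ->
  (0 <= g)%R -> (g <= a)%R ->
  (a * g * euclidean_dist x y ^+ (2 * n) < s ^+ 2)%R ->
  exists k, cube x (rho * 2 ^+ k) y /\ (g <= a * 4 ^+ n / (4 ^+ k) ^+ n)%R.
Proof.
move=> a0 rho0 -> g0 ga agd.
have [k] : exists k, (euclidean_dist x y < rho * 2 ^+ k)%R.
  exists (Num.truncn (euclidean_dist x y / rho)).+1.
  rewrite mulrC -ltr_pdivrMr//.
  apply: lt_trans (truncnS_gt _) _.
  by rewrite -natrX ltr_nat ltn_expl.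
elim: k => [|k IH] dk.
  exists 0%N; split; first exact: euclidean_dist_cube.
  rewrite expr0 expr1n divr1; apply: (le_trans ga).
  by rewrite ler_peMr ?exprn_ege1 ?ler1n// ltW.
have [/IH//|kd] := ltP (euclidean_dist x y) (rho * 2 ^+ k)%R.
exists k.+1; split; first exact: euclidean_dist_cube.
have rk0 : (0 < rho * 2 ^+ k)%R by rewrite mulr_gt0// exprn_gt0.
have : (a * g * (rho * 2 ^+ k) ^+ (2 * n) < (a * rho ^+ n) ^+ 2)%R.
  apply: le_lt_trans agd; rewrite ler_wpM2l ?mulr_ge0 ?(ltW a0)//.
  by rewrite lerXn2r ?nnegrE ?euclidean_dist_ge0// ltW.
have -> : (a * g * (rho * 2 ^+ k) ^+ (2 * n) =
           (a * rho ^+ n ^+ 2) * (g * (4 ^+ k) ^+ n))%R.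
  have -> : ((4 ^+ k) ^+ n = (2 ^+ k) ^+ n ^+ 2 :> R)%R.
    by rewrite (_ : 4 = 2 ^+ 2)%R; [rewrite -!exprM mulnC !mulnA|ring].
  by rewrite [(2 * n)%N]mulnC exprM exprMn; ring.
have -> : ((a * rho ^+ n) ^+ 2 = (a * rho ^+ n ^+ 2) * a)%R by ring.
rewrite ltr_pM2l ?mulr_gt0 ?exprn_gt0// => /ltW.
have p0 m : (0 < 4 ^+ m :> R)%R by rewrite exprn_gt0.
rewrite exprS exprMn invfM mulrA mulfK ?gt_eqF//.
by rewrite ler_pdivlMr// exprn_gt0.
Qed.

(** Up to constants, on [A] the function [g] is at most [a] inside a cube of
    volume [s / a] and decays like the power [- 2 * n] of the distance outside.
    Since this exponent is below [- n], the cube dominates, and it contributes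
    [a * (s / a) = s]. The point is that the bound does not depend on [a]. *)
Lemma integral_near_pair_le (a s : R) (g : Rn R n -> R) x (A : set (Rn R n)) :
  (0 < a)%R -> (0 < s)%R -> measurable_fun [set: _] g ->
  (forall y, (0 <= g y)%R) -> measurable A ->
  A `<=` [set y | (g y <= a)%R /\
                  (a * g y * euclidean_dist x y ^+ (2 * n) < s ^+ 2)%R] ->
  \int[lebesgue R n]_y ((g y)%:E * (\1_A y)%:E) <= (2 * 8 ^+ n * s)%:E.
Proof.
move=> a0 s0 mg g0 mA Asub.
(* [rho] is chosen so that [a * rho ^+ n = s]. *)
pose rho := ((s / a) `^ (n%:R)^-1)%R.
have rho0 : (0 < rho)%R by rewrite powR_gt0// divr_gt0.
have rhoE : (s = a * rho ^+ n)%R.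
  rewrite -powR_mulrn ?powR_ge0// -powRrM mulVf ?pnatr_eq0 -?lt0n//.
  by rewrite powRr1 ?divr_ge0 ?ltW// mulrCA divff ?mulr1 ?gt_eqF.
pose c k : R := (a * 4 ^+ n / (4 ^+ k) ^+ n)%R.
have c0 k : (0 <= c k)%R by rewrite /c divr_ge0 ?mulr_ge0 ?exprn_ge0// ltW.
pose u k y : \bar R := (c k)%:E * (\1_(cube x (rho * 2 ^+ k)) y)%:E.
have mu k : measurable_fun [set: Rn R n] (u k).
  apply: emeasurable_funM; first exact: measurable_cst.
  by apply/measurable_EFinP/measurable_indicP; exact: measurable_cube.
have u0 k y : 0 <= u k y by rewrite mule_ge0 ?lee_fin.
have gu y : (g y)%:E * (\1_A y)%:E <= \sum_(k <oo) u k y.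
  rewrite indicE; case: (boolP (y \in A)) => [|_]; last first.
    by rewrite mule0; exact: nneseries_ge0.
  move=> /set_mem /Asub[ga agd].
  rewrite mule1; have [k [Qy gc]] := dyadic_layer a0 rho0 rhoE (g0 y) ga agd.
  apply: le_trans (nneseries_lim_ge k.+1 _); last by [].
  rewrite big_nat_recr//= -[leLHS]add0e leeD ?sume_ge0//.
  by rewrite /u indicE mem_set// mule1 lee_fin.
apply: le_trans (_ : \int[lebesgue R n]_y (\sum_(k <oo) u k y) <= _).
  apply: ge0_le_integral => //.
  - by move=> y _; rewrite mule_ge0 ?lee_fin.
  - apply: emeasurable_funM; first exact/measurable_EFinP.
    exact/measurable_EFinP/measurable_indicP.
  - exact: ge0_emeasurable_sum.
rewrite integral_nneseries//.
(* The k-th layer contributes [8 ^+ n * s / 2 ^+ (k * n)]. *)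
apply: le_trans (epsilon_trick0 xpredT _); last first.
  by rewrite !mulr_ge0 ?exprn_ge0// ltW.
apply: lee_nneseries => [k _ _|k _]; first exact: integral_ge0.
rewrite ge0_integralZl//; last 2 first.
- by apply/measurable_EFinP/measurable_indicP; exact: measurable_cube.
- by rewrite lee_fin.
rewrite integral_indic//; last exact: measurable_cube.
have rk0 : (0 < rho * 2 ^+ k)%R by rewrite mulr_gt0// exprn_gt0.
rewrite setIT [X in _ * X](lebesgue_cube x rk0) -EFinM lee_fin.
have p0 m : (0 < 2 ^+ m :> R)%R by rewrite exprn_gt0.
have -> : (c k * (2 * (rho * 2 ^+ k)) ^+ n = 8 ^+ n * s / (2 ^+ k) ^+ n)%R.
  rewrite rhoE /c !exprMn (_ : 8 = 2 * 4)%R; last by ring.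
  rewrite (_ : (4 ^+ k) ^+ n = (2 ^+ k) ^+ n ^+ 2)%R; last first.
    by rewrite (_ : 4 = 2 ^+ 2)%R; [rewrite -!exprM mulnC !mulnA|ring].
  rewrite exprMn.
  have : ((2 ^+ k) ^+ n != 0 :> R)%R by rewrite gt_eqF ?exprn_gt0.
  by move: (2 ^+ n)%R (4 ^+ n)%R ((2 ^+ k) ^+ n)%R => z w v v0; field.
have -> : (2 * 8 ^+ n * s / (2 ^ k.+1)%:R = 8 ^+ n * s / 2 ^+ k)%R.
  rewrite natrX exprS; have := p0 k; set z := (2 ^+ k)%R => z0.
  by field; rewrite gt_eqF.
rewrite ler_wpM2l ?mulr_ge0 ?exprn_ge0 ?(ltW s0)// lef_pV2 ?posrE ?exprn_gt0//.
by rewrite ler_eXnr// exprn_ege1// ler1n.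
Qed.

End cubes.

(** * The lower bound for probability densities *)

Lemma prod_offdiag (R : comPzRingType) N (h : 'I_N -> 'I_N -> R) :
  (\prod_(j < N) \prod_(i < N | i != j) h i j =
   \prod_(i < N) \prod_(j < N | (i < j)%N) (h i j * h j i))%R.
Proof.
under eq_bigr => j _.
  rewrite (bigID (fun i : 'I_N => (i < j)%N))/=.
  rewrite (eq_bigl (fun i : 'I_N => (i < j)%N)); last first.
    move=> i; rewrite andbC; case: ltnP => //= ij.
    by apply: contraTneq ij => ->; rewrite ltnn.
  rewrite [X in (_ * X)%R](eq_bigl (fun i : 'I_N => (j < i)%N)); last first.
    by move=> i; rewrite -leqNgt ltn_neqAle eq_sym.
  over.
rewrite big_split/= (exchange_big_dep xpredT)//= -big_split/=.
by apply: eq_bigr => i _; rewrite -big_split.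
Qed.

Lemma powR_sum (R : realType) (I : finType) (P : pred I) (u : I -> R) (a : R) :
  (0 < a)%R -> (a `^ (\sum_(i | P i) u i) = \prod_(i | P i) a `^ u i)%R.
Proof.
move=> a0; apply: (big_morph (powR a)); last exact: powRr0.
by move=> x y; apply: powRD; rewrite (gt_eqF a0) implybT.
Qed.

Section lower_bound.
Context (R : realType) (n N : nat) (r : 'I_N -> 'I_N -> R) (p : 'I_N -> R).
Hypothesis n_gt0 : (0 < n)%N.
Hypothesis r_sym : forall i j : 'I_N, i != j -> (0 < r i j)%R /\ r i j = r j i.
Hypothesis p_r : forall j,
  (1 / p j = 1 / (2 * n%:R) * \sum_(i < N | i != j) r i j)%R.

(** The exponents [1 / p j] are exactly those for which the right-hand side
    regroups into factors indexed by pairs: it is the product over [i < j] of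
    [(a i * a j * D i j ^+ (2 * n)) `^ w] with [w = r i j / (2 * n)]. *)
Lemma prod_pair_bound (a : 'I_N -> R) (D : 'I_N -> 'I_N -> R) (s : R) :
  (0 < s)%R -> (forall k, 0 < a k)%R -> (forall i j, 0 <= D i j)%R ->
  (forall i j : 'I_N, (i < j)%N -> s ^+ 2 <= a i * a j * D i j ^+ (2 * n))%R ->
  (\prod_(i < N) \prod_(j < N | (i < j)%N) s `^ (r i j / n%:R) <=
   (\prod_(j < N) a j `^ (1 / p j)) *
   \prod_(i < N) \prod_(j < N | (i < j)%N) D i j `^ r i j)%R.
Proof.
move=> s0 a0 D0 saD.
have n0 : (n%:R != 0 :> R)%R by rewrite pnatr_eq0 -lt0n.
under [X in (_ <= X * _)%R]eq_bigr => j _.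
  rewrite p_r mulr_sumr powR_sum//; over.
rewrite (prod_offdiag (fun i j => a j `^ (1 / (2 * n%:R) * r i j))%R).
rewrite -big_split/=; apply: ler_prod => i _; apply/andP; split.
  by apply: prodr_ge0 => j _; exact: powR_ge0.
rewrite -big_split/=; apply: ler_prod => j ij; rewrite powR_ge0/=.
have [rij0 rji] : (0 < r i j)%R /\ r i j = r j i.
  by apply: r_sym; rewrite neq_ltn ij.
set w := (1 / (2 * n%:R) * r i j)%R.
have w0 : (0 <= w)%R by rewrite mulr_ge0 ?divr_ge0 ?mulr_ge0 ?ler0n// ltW.
have -> : (s `^ (r i j / n%:R) = (s ^+ 2) `^ w)%R.
  rewrite -powR_mulrn ?ltW// -powRrM; congr (_ `^ _)%R.
  by rewrite /w; field.
have -> : (D i j `^ r i j = (D i j ^+ (2 * n)) `^ w)%R.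
  rewrite -powR_mulrn// -powRrM; congr (_ `^ _)%R.
  by rewrite natrM /w; field.
rewrite -rji -/w [X in (_ <= X * _)%R]mulrC -powRM ?(ltW (a0 _))//.
rewrite -powRM ?mulr_ge0 ?exprn_ge0 ?(ltW (a0 _))//.
by rewrite ge0_ler_powR// ?nnegrE ?mulr_ge0 ?exprn_ge0 ?(ltW (a0 _)) ?saD// ltW.
Qed.

(** The quantity in the last clause is the two-point functional of the pair;
    the second clause breaks the symmetry, so that for a fixed first point
    [x] the values of [G] that matter are capped by [F x]. *)
Definition close_pairs (F G : Rn R n -> R) (s : R) : set (Rn R n * Rn R n) :=
  [set z | [/\ (0 < F z.1)%R, (G z.2 <= F z.1)%R &
    (F z.1 * G z.2 * euclidean_dist z.1 z.2 ^+ (2 * n) < s ^+ 2)%R]].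

Lemma measurable_close_pairs (F G : Rn R n -> R) (s : R) :
  measurable_fun [set: _] F -> measurable_fun [set: _] G ->
  measurable (close_pairs F G s).
Proof.
move=> mF mG.
have mF1 := measurableT_comp mF (@measurable_fst _ _ (Rn R n) (Rn R n)).
have mG2 := measurableT_comp mG (@measurable_snd _ _ (Rn R n) (Rn R n)).
have mlt (f g : Rn R n * Rn R n -> R) : measurable_fun [set: _] f ->
    measurable_fun [set: _] g -> measurable [set z | (f z < g z)%R].
  move=> mf mg; have := measurable_fun_ltr mf mg.
  by move=> /(_ measurableT [set true]); rewrite setTI; apply.
have mle (f g : Rn R n * Rn R n -> R) : measurable_fun [set: _] f ->
    measurable_fun [set: _] g -> measurable [set z | (f z <= g z)%R].
  move=> mf mg; have := measurable_fun_ler mf mg.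
  by move=> /(_ measurableT [set true]); rewrite setTI; apply.
rewrite (_ : close_pairs F G s =
  [set z | (0 < F z.1)%R] `&` [set z | (G z.2 <= F z.1)%R] `&`
  [set z | (F z.1 * G z.2 * euclidean_dist z.1 z.2 ^+ (2 * n) < s ^+ 2)%R]);
  last first.
  by apply/seteqP; split=> [z []//|z [[]]].
apply: measurableI; first by apply: measurableI; [exact: mlt|exact: mle].
apply: mlt => //; apply: measurable_funM; first exact: measurable_funM.
by apply: measurable_funX; exact: measurable_euclidean_dist.
Qed.

Lemma integral_close_pairs_le (F G : Rn R n -> R) (s : R) x : (0 < s)%R ->
  measurable_fun [set: _] F -> measurable_fun [set: _] G ->
  (forall y, 0 <= G y)%R ->
  \int[lebesgue R n]_y ((G y)%:E * (\1_(close_pairs F G s) (x, y))%:E) <=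
  (2 * 8 ^+ n * s)%:E.
Proof.
move=> s0 mF mG G0; have [Fx0|Fx0] := ltP 0%R (F x); last first.
  rewrite integral0_eq ?lee_fin ?mulr_ge0 ?exprn_ge0 ?(ltW s0)//.
  move=> y _; rewrite indicE memNset ?mule0// => -[/= + _ _].
  by rewrite ltNge Fx0.
have mE : measurable (xsection (close_pairs F G s) x).
  by apply: measurable_xsection; exact: measurable_close_pairs.
apply: le_trans (integral_near_pair_le (x := x) n_gt0 Fx0 s0 mG G0 mE _).
  rewrite le_eqVlt; apply/orP; left; apply/eqP; apply: eq_integral => y _.
  by rewrite !indicE mem_xsection.
by move=> y /xsectionP[_ GF FG]; split.
Qed.

(** Draw independent points [y_k] with densities [F k]. If [e] were smaller than
    the left-hand side, then by [prod_pair_bound] almost every configuration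
    with all [F k y_k] positive would contain two indices forming a close pair.
    But each of the at most [N * N] ordered pairs is close with probability at
    most [2 * 8 ^+ n * s], and these probabilities add up to less than 1. *)
Lemma densities_lower_bound (F : 'I_N -> Rn R n -> R) (s e : R) :
  (0 < s)%R -> ((N * N)%:R * (2 * 8 ^+ n * s) < 1)%R ->
  (forall k, measurable_fun [set: _] (F k)) -> (forall k x, 0 <= F k x)%R ->
  (forall k, \int[lebesgue R n]_x (F k x)%:E = 1) ->
  {ae lebesgue_pow R n N, forall y : N.-tuple (Rn R n),
    ((\prod_(k < N) F k (tnth y k) `^ (1 / p k)) *
     \prod_(i < N) \prod_(j < N | (i < j)%N)
       euclidean_dist (tnth y i) (tnth y j) `^ r i j <= e)%R} ->
  (\prod_(i < N) \prod_(j < N | (i < j)%N) s `^ (r i j / n%:R) <= e)%R.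
Proof.
move=> s0 sN mF F0 F1 aee; rewrite leNgt; apply/negP => ec.
pose P (y : N.-tuple (Rn R n)) := \prod_(k < N) (F k (tnth y k))%:E.
pose K i j z : \bar R := (\1_(close_pairs (F i) (F j) s) z)%:E.
pose g (q : 'I_N * 'I_N) y :=
  if q.1 != q.2 then P y * K q.1 q.2 (tnth y q.1, tnth y q.2) else 0.
have mFE k : measurable_fun [set: _] (EFin \o F k) by exact/measurable_EFinP.
have P0 y : 0 <= P y by apply: prode_ge0 => k _; rewrite lee_fin.
have K0 i j z : 0 <= K i j z by rewrite lee_fin.
have mP : measurable_fun [set: _] P by exact: (measurable_prod_tnth mFE).
have mK i j : measurable_fun [set: _] (K i j).
  apply/measurable_EFinP/measurable_indicP; exact: measurable_close_pairs.
have g0 q y : 0 <= g q y by rewrite /g; case: ifP => // _; rewrite mule_ge0.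
have mg q : measurable_fun [set: _] (g q).
  rewrite /g; case: (q.1 != q.2) => //; apply: emeasurable_funM => //.
  apply: (measurableT_comp (mK q.1 q.2)).
  by apply: measurable_fun_pair; exact: measurable_tnth.
have IP : \int[lebesgue_pow R n N]_y P y = 1.
  rewrite [LHS](ge0_integral_prod_tnth _ mFE)/=; first by rewrite big1.
  by move=> k x; rewrite lee_fin.
have Ig q : \int[lebesgue_pow R n N]_y g q y <= (2 * 8 ^+ n * s)%:E.
  rewrite /g; have [_|ij] := eqVneq q.1 q.2.
    by rewrite /= integral0 lee_fin ?mulr_ge0 ?exprn_ge0// ltW.
  apply: (@ge0_integral_prod_tnth_pair_le _ _ _ (lebesgue R n) N
    (fun k => EFin \o F k) (K q.1 q.2)) => //.
  - by rewrite lee_fin ?mulr_ge0 ?exprn_ge0// ltW.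
  - by move=> x; exact: integral_close_pairs_le.
(* Almost everywhere, [P y] vanishes or is one of the terms [g q y]. *)
have : 1 <= \sum_(q : 'I_N * 'I_N) (2 * 8 ^+ n * s)%:E.
  apply: le_trans (lee_sum _ (fun q _ => Ig q)).
  rewrite -ge0_integral_sum// -IP; apply: ae_ge0_le_integral => //.
  - by move=> y _; exact: sume_ge0.
  - exact: emeasurable_sum.
  apply: filterS aee => y ye _.
  have [[q [q12 qE]]|noE] := pselect (exists q : 'I_N * 'I_N, q.1 != q.2 /\
      close_pairs (F q.1) (F q.2) s (tnth y q.1, tnth y q.2)).
    rewrite (bigD1 q)//= {1}/g q12 /K indicE mem_set// mule1 leeDl//.
    exact: sume_ge0.
  suff -> : P y = 0 by exact: sume_ge0.
  rewrite /P prodEFin; congr EFin; apply/eqP; rewrite prodf_seq_eq0; apply/hasP.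
  apply: contrapT => noF; move: ec; apply/negP; rewrite -leNgt.
  have Fy k : (0 < F k (tnth y k))%R.
    rewrite lt_neqAle F0 andbT eq_sym; apply/negP => Fk; apply: noF.
    by exists k; rewrite ?mem_index_enum.
  apply: le_trans ye; apply: prod_pair_bound => // [i j|i j ij].
    exact: euclidean_dist_ge0.
  rewrite leNgt; apply/negP => Fij; apply: noE.
  have nij : i != j by rewrite neq_ltn ij.
  have [FF|/ltW FF] := leP (F j (tnth y j)) (F i (tnth y i)).
    by exists (i, j).
  exists (j, i); rewrite eq_sym; split => //; split => //=.
  by rewrite euclidean_distC [X in (X * _)%R]mulrC.
rewrite sumEFin sumr_const card_prod card_ord lee_fin -[leRHS]mulr_natl.
by rewrite leNgt sN.
Qed.

End lower_bound.

(** * Reduction to probability densities *)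

Lemma lee_prod (R : realType) (I : Type) (s : seq I) (x y : I -> \bar R) :
  (forall i, 0 <= x i <= y i) -> \prod_(i <- s) x i <= \prod_(i <- s) y i.
Proof.
move=> xy; elim: s => [|i s IH]; first by rewrite !big_nil.
have /andP[x0 xyi] := xy i; rewrite !big_cons lee_pmul//.
by apply: prode_ge0 => j _; have /andP[] := xy j.
Qed.

Lemma lte_EFin_between (R : realType) (a : R) (x : \bar R) :
  a%:E < x -> exists2 b : R, (a < b)%R & b%:E < x.
Proof.
case: x => [x||]//; rewrite ?lte_fin => ax.
  by exists ((a + x) / 2)%R; rewrite ?lte_fin; lra.
by exists (a + 1)%R; rewrite ?ltry// ltrDl.
Qed.

(** Passes from factors of finite size to possibly infinite ones: a product of
    positive extended reals is the supremum of the products of the positive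
    reals below its factors. *)
Lemma prode_le_of_lt (R : realType) N (x : 'I_N -> \bar R) (K : R) :
  (forall j, 0 < x j) ->
  (forall b : 'I_N -> R, (forall j, (0 < b j)%R /\ (b j)%:E < x j) ->
    (\prod_(j < N) b j <= K)%R) ->
  \prod_(j < N) x j <= K%:E.
Proof.
elim: N x K => [|N IH] x K x0 xK.
  have := xK (fun=> 1%R); rewrite !big_ord0 lee_fin; apply.
  by case.
have Kb (b0 : R) : (0 < b0)%R -> b0%:E < x ord0 ->
    \prod_(j < N) x (lift ord0 j) <= (K / b0)%:E.
  move=> b00 b0x; apply: IH => // b bx; rewrite ler_pdivlMr// mulrC.
  have := xK (fun j => if unlift ord0 j is Some k then b k else b0).
  rewrite big_ord_recl unlift_none; under eq_bigr do rewrite liftK; apply.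
  by move=> j; case: (unliftP ord0 j) => [k ->|->].
have [b0 b00 b0x] := lte_EFin_between (x0 ord0).
rewrite big_ord_recl.
have : 0 < \prod_(j < N) x (lift ord0 j).
  by elim/big_ind : _ => // y z; exact: mule_gt0.
move: (\prod_(j < N) x (lift ord0 j)) Kb => [q||] Kb // q0; last first.
  by have := Kb _ b00 b0x; rewrite leye_eq.
rewrite lte_fin in q0.
have Kq b : (0 < b)%R -> b%:E < x ord0 -> (b <= K / q)%R.
  move=> b_0 bx; rewrite ler_pdivlMr// mulrC -ler_pdivlMr//.
  by rewrite -lee_fin Kb.
rewrite -lee_pdivlMr// leNgt; apply/negP => /lte_EFin_between[b Kqb bx].
have b_0 : (0 < b)%R.
  by apply: lt_trans Kqb; apply: lt_le_trans (Kq _ b00 b0x).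
by have := Kq _ b_0 bx; rewrite leNgt Kqb.
Qed.

(** Truncate [G] in height and to a set of finite measure; monotone convergence
    along an exhaustion brings the integral above any number below that of
    [G]. *)
Lemma finite_integral_minorant d (T : measurableType d) (R : realType)
    (mu : {sigma_finite_measure set T -> \bar R}) (G : T -> \bar R) (a : R) :
  measurable_fun [set: T] G -> (forall x, 0 <= G x) -> a%:E < \int[mu]_x G x ->
  exists H : T -> R, [/\ measurable_fun [set: T] H, forall x, (0 <= H x)%R,
    forall x, (H x)%:E <= G x & a%:E < \int[mu]_x (H x)%:E < +oo].
Proof.
move=> mG G0 aG.
have /sigma_finiteP[D [TD ndD Doo]] := sigma_finiteT mu.
pose h k x := mine (G x) k%:R%:E * (\1_(D k) x)%:E.
have mh k : measurable_fun [set: T] (h k).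
  apply: emeasurable_funM.
    by apply: measurable_mine => //; exact: measurable_cst.
  by apply/measurable_EFinP/measurable_indicP; case: (Doo k).
have min0 k x : 0 <= mine (G x) k%:R%:E by rewrite le_min G0 lee_fin ler0n.
have h0 k x : 0 <= h k x by rewrite mule_ge0 ?lee_fin.
have hG k x : h k x <= G x.
  rewrite /h indicE; case: (x \in D k); rewrite ?mule1 ?mule0//.
  by rewrite ge_min lexx.
have hk k x : h k x <= (k%:R * \1_(D k) x)%:E.
  by rewrite EFinM lee_wpmul2r ?lee_fin// ge_min lexx orbT.
have ndh x : nondecreasing_seq (h ^~ x).
  move=> k l kl; apply: lee_pmul => //; rewrite ?lee_fin//.
    by rewrite le_min !ge_min lexx/= lee_fin ler_nat kl orbT.
  rewrite !indicE ler_nat; case: (boolP (x \in D k)) => // /set_mem xD.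
  by rewrite mem_set//; move/subsetPset: (ndD _ _ kl); apply.
have GE x : G x = limn (h ^~ x).
  rewrite (cvg_lim _ (ereal_nondecreasing_cvgn (ndh x)))//.
  have [k0 _ Dx] : (\bigcup_i D i) x by rewrite -TD.
  apply/eqP; rewrite eq_le; apply/andP; split; last first.
    by apply: ge_ereal_sup => _ [k _ <-].
  set l := ereal_sup _; rewrite leNgt; apply/negP => lG.
  have hl k : h k x <= l by apply: ereal_sup_ubound; exists k.
  have l0 : 0 <= l by apply: le_trans (h0 0%N x) (hl _).
  have lE : (fine l)%:E = l.
    by rewrite fineK// ge0_fin_numE// (lt_le_trans lG)// leey.
  rewrite -lE in lG hl; have [b lb bG] := lte_EFin_between lG.
  have := hl (maxn k0 (Num.truncn b).+1).
  rewrite /h indicE mem_set; last first.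
    by move/subsetPset: (ndD _ _ (leq_maxl k0 (Num.truncn b).+1)); apply.
  rewrite mule1 leNgt => /negP; apply.
  rewrite lt_min (lt_trans _ bG) ?lte_fin//=.
  apply: (lt_trans lb); apply: (lt_le_trans (truncnS_gt _)).
  by rewrite ler_nat leq_maxr.
move: aG; rewrite (eq_integral (fun x => limn (h ^~ x))) => [|x _].
  2: exact: GE.
rewrite monotone_convergence//.
rewrite (cvg_lim _ (ereal_nondecreasing_cvgn _))//; last first.
  by move=> k l kl; apply: ge0_le_integral => // x _; exact: ndh.
move=> /ereal_sup_gt[_ [k _ <-] ak].
have hfin x : (fine (h k x))%:E = h k x.
  by rewrite fineK// ge0_fin_numE// (le_lt_trans (hk k x)) ?ltry.
exists (fun x => fine (h k x)); split.
- exact: (measurableT_comp (fine_measurable measurableT) (mh k)).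
- by move=> x; rewrite fine_ge0.
- by move=> x; rewrite hfin.
under eq_integral do rewrite hfin.
rewrite ak/=; have [mD Dk] := Doo k.
apply: (@le_lt_trans _ _ (\int[mu]_x (k%:R%:E * (\1_(D k) x)%:E))).
  apply: ge0_le_integral => //.
  by apply: emeasurable_funM => //; apply/measurable_EFinP/measurable_indicP.
rewrite ge0_integralZl//; last exact/measurable_EFinP/measurable_indicP.
by rewrite integral_indic// setIT lte_mul_pinfty// lee_fin.
Qed.

Lemma completed_measurable_fun_comp d (T : measurableType d) (R : realType)
    (mu : {measure set T -> \bar R}) (f : T -> \bar R) (g : \bar R -> \bar R) :
  completed_measurable_fun mu f -> measurable_fun [set: \bar R] g ->
  completed_measurable_fun mu (g \o f).
Proof.
move=> mf mg B mB; have := mf (g @^-1` B); apply.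
by rewrite -[X in measurable X]setTI; exact: mg.
Qed.

Lemma lebesgue_pow_gt0 (R : realType) n N : 0 < lebesgue_pow R n N [set: _].
Proof.
have T0 d (T : measurableType d)
    (mu : {sigma_finite_measure set T -> \bar R}) m :
    0 < mu [set: T] -> 0 < tuple_measure mu m [set: _].
  move=> mu0; rewrite [ltRHS](_ : _ = \prod_(i < m) mu [set: T]).
    by elim/big_ind : _ => // y z; exact: mule_gt0.
  rewrite -(@tuple_measureX _ _ _ mu m (fun=> [set: T]))//.
  by congr (tuple_measure mu m _); apply/seteqP; split.
apply: (T0 _ _ _ _ (T0 _ _ _ _ _)); rewrite [ltRHS](_ : _ = +oo)//.
rewrite -[LHS]/(lebesgue_measure [set: R]) -set_itvNyy.
by rewrite lebesgue_measure_itv/=.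
Qed.

Theorem theorem3p7 (R : realType) (n N : nat)
    (r : 'I_N -> 'I_N -> R) (p : 'I_N -> R) :
  (1 <= n)%N -> (0 < N)%N ->
  (forall i j : 'I_N, i != j -> (0 < r i j)%R /\ r i j = r j i) ->
  (forall j : 'I_N, (0 < p j)%R) ->
  (forall j : 'I_N,
     (1 / p j = 1 / (2 * n%:R) * \sum_(i < N | i != j) r i j)%R) ->
  (\sum_(j < N) 1 / p j =
     1 / n%:R * \sum_(i < N) \sum_(j < N | (i < j)%N) r i j)%R ->
  exists C : R, forall f : 'I_N -> Rn R n -> \bar R,
    (forall j x, 0 <= f j x) ->
    (forall j, Lebesgue_measurable_fun (f j)) ->
    \prod_(j < N) 'N[lebesgue R n]_((p j)%:E)[f j] <=
      C%:E * ess_sup (lebesgue_pow R n N) (fun y : N.-tuple (Rn R n) =>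
        (\prod_(j < N) f j (tnth y j)) *
        (\prod_(i < N) \prod_(j < N | (i < j)%N)
           euclidean_dist (tnth y i) (tnth y j) `^ r i j)%R%:E).
Proof.
move=> n1 N0 r_sym p0 p_r _.
(* [s] is any positive number with [c * s < 1]. *)
pose c : R := ((N * N)%:R * (2 * 8 ^+ n))%R.
have c0 : (0 <= c)%R by rewrite !mulr_ge0 ?exprn_ge0.
pose s : R := (c + 1)^-1%R.
have s0 : (0 < s)%R by rewrite invr_gt0 ltr_wpDl.
have sN : ((N * N)%:R * (2 * 8 ^+ n * s) < 1)%R.
  by rewrite [X in (X < _)%R]mulrA ltr_pdivrMr ?mul1r ?ltrDl// ltr_wpDl.
pose m : R := (\prod_(i < N) \prod_(j < N | (i < j)%N) s `^ (r i j / n%:R))%R.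
have m0 : (0 < m)%R.
  by apply: prodr_gt0 => i _; apply: prodr_gt0 => j _; exact: powR_gt0.
exists m^-1%R => f f0 mf; set S := ess_sup _ _.
have D0 y : (0 <= \prod_(i < N) \prod_(j < N | (i < j)%N)
    euclidean_dist (tnth y i) (tnth y j) `^ r i j :> R)%R.
  by apply: prodr_ge0 => i _; apply: prodr_ge0 => j _; exact: powR_ge0.
have S0 : 0 <= S.
  apply: ess_sup_gee; first exact: lebesgue_pow_gt0.
  by apply: nearW => y; rewrite mule_ge0 ?lee_fin ?D0//; exact: prode_ge0.
have [[j Nj]|Nn0] := pselect (exists j, 'N[lebesgue R n]_((p j)%:E)[f j] = 0).
  rewrite (bigD1 j)//= Nj mul0e mule_ge0// lee_fin invr_ge0; exact: ltW.
have Ngt0 j : 0 < 'N[lebesgue R n]_((p j)%:E)[f j].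
  rewrite lt_neqAle Lnorm_ge0 andbT eq_sym.
  by apply/negP => /eqP Nj; apply: Nn0; exists j.
have aeS := ess_sup_ge (lebesgue_pow R n N) (fun y : N.-tuple (Rn R n) =>
        (\prod_(j < N) f j (tnth y j)) *
        (\prod_(i < N) \prod_(j < N | (i < j)%N)
           euclidean_dist (tnth y i) (tnth y j) `^ r i j)%R%:E).
rewrite -/S in aeS; move: S S0 aeS => [e||]// e0 aee; last first.
  by rewrite gt0_muley ?leey// lte_fin invr_gt0.
(* Every norm is positive and the supremum [e] is finite. A norm may still be
   infinite, so it is approached from below by a real number [b j]. *)
rewrite -EFinM; apply: prode_le_of_lt => // b bN.
(* That [b j] is below the norm of [f j] means that [b j ^ p j] is below the
   integral of [f j ^ p j]. *)
have minorant j : exists H : Rn R n -> R, [/\ measurable_fun [set: _] H,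
    forall x, (0 <= H x)%R, forall x, (H x)%:E <= f j x `^ p j &
    (b j `^ p j)%:E < \int[lebesgue R n]_x (H x)%:E < +oo].
  have [G [mG G0 _ IG]] := completed_measurable_fun_integral
    (completed_measurable_fun_comp (mf j) (measurable_poweR (p j)))
    (fun x => poweR_ge0 (f j x) (p j)).
  have bG : (b j `^ p j)%:E < \int[lebesgue R n]_x G x.
    rewrite ltNge; apply/negP => Gb; have [b0] := bN j; apply/negP.
    rewrite -leNgt unlock; under eq_integral do rewrite gee0_abs//.
    rewrite [X in X `^ _]IG.
    have -> : (b j)%:E = ((b j `^ p j) `^ (p j)^-1)%:E.
      by rewrite -powRrM mulfV ?gt_eqF// powRr1// ltW.
    rewrite -poweR_EFin; apply: gt0_ler_poweR => //.
    - by rewrite invr_ge0 ltW.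
    - rewrite in_itv/= leey andbT; apply: integral_ge0 => x _.
      by have /andP[] := G0 x.
    - by rewrite in_itv/= leey andbT lee_fin powR_ge0.
  have [|H [mH H0 HG bH]] := finite_integral_minorant mG _ bG.
    by move=> x; have /andP[] := G0 x.
  by exists H; split => // x; apply: le_trans (HG x) _; have /andP[] := G0 x.
have {minorant}[H Hb] := choice minorant.
pose I j : R := fine (\int[lebesgue R n]_x (H j x)%:E).
have IE j : (I j)%:E = \int[lebesgue R n]_x (H j x)%:E.
  rewrite fineK// ge0_fin_numE; first by have [_ _ _ /andP[]] := Hb j.
  by apply: integral_ge0 => x _; have [_ H0 _ _] := Hb j; rewrite lee_fin.
have bI j : (b j `^ p j < I j)%R.
  by rewrite -lte_fin IE; have [_ _ _ /andP[]] := Hb j.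
have I0 j : (0 < I j)%R by apply: le_lt_trans (bI j); exact: powR_ge0.
pose Q : R := (\prod_(j < N) I j `^ (1 / p j))%R.
have Q0 : (0 < Q)%R by apply: prodr_gt0 => j _; exact: powR_gt0.
have bQ : (\prod_(j < N) b j <= Q)%R.
  apply: ler_prod => j _; have [b0 _] := bN j; rewrite ltW//=.
  have {1}-> : b j = ((b j `^ p j) `^ (1 / p j))%R.
    by rewrite -powRrM div1r mulfV ?gt_eqF// powRr1// ltW.
  by rewrite ge0_ler_powR// ?nnegrE ?powR_ge0// ltW// divr_gt0.
(* For the densities [H j / I j], the bound [e] becomes [e / Q]. *)
apply: (le_trans bQ); rewrite mulrC ler_pdivlMr// mulrC -ler_pdivlMr//.
apply: (densities_lower_bound n1 r_sym p_r
  (F := fun j x => (H j x / I j)%R)) => //.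
- move=> j; have [mH _ _ _] := Hb j.
  by apply: measurable_funM => //; exact: measurable_cst.
- by move=> j x; have [_ H0 _ _] := Hb j; rewrite divr_ge0// ltW.
- move=> j; have [mH H0 _ _] := Hb j.
  under eq_integral do rewrite EFinM.
  rewrite ge0_integralZr//; last 3 first.
  - exact/measurable_EFinP.
  - by move=> x _; rewrite lee_fin.
  - by rewrite lee_fin invr_ge0 ltW.
  by rewrite -IE -EFinM divff// gt_eqF.
apply: filterS aee => y ye; rewrite ler_pdivlMr// mulrAC.
have -> : (\prod_(j < N) (H j (tnth y j) / I j) `^ (1 / p j) * Q =
    \prod_(j < N) H j (tnth y j) `^ (1 / p j))%R.
  rewrite -big_split/=; apply: eq_bigr => j _; have [_ H0 _ _] := Hb j.
  by rewrite -powRM ?divfK ?gt_eqF// ?divr_ge0// ltW.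
rewrite -lee_fin EFinM; apply: le_trans ye; rewrite lee_wpmul2r ?lee_fin//.
rewrite -prodEFin; apply: lee_prod => j; rewrite lee_fin powR_ge0/=.
have [_ H0 Hf _] := Hb j.
have -> : f j (tnth y j) = (f j (tnth y j) `^ p j) `^ (1 / p j).
  by rewrite -poweRrM div1r mulfV ?gt_eqF// poweRe1.
rewrite -poweR_EFin; apply: gt0_ler_poweR => //.
- by rewrite divr_ge0// ltW.
- by rewrite in_itv/= leey andbT lee_fin.
- by rewrite in_itv/= leey andbT poweR_ge0.
Qed.
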